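(* Let $(A,\nwarrow,\nearrow,\alpha)$ be a $3$-Hom-L-dendriform algebra. Then $(A,\nwarrow,\nearrow,\alpha)$ has a product structure if and only if $A$ admits a decomposition (direct sum of vector spaces) $$A=A_+\oplus A_-,$$ where $A_+$ and $A_-$ are subalgebras of $A$.
   Context: Vector spaces are finite-dimensional over $\mathbb R$ or $\mathbb C$. A $3$-Hom-L-dendriform algebra is a tuple $(A,\nwarrow,\nearrow,\alpha)$ where $A$ is a vector space, $\nwarrow,\nearrow:\otimes^3A\to A$ and $\alpha:A\to A$ are linear, $\alpha$ is multiplicative (i.e. $\alpha(\nwarrow(x,y,z))=\nwarrow(\alpha(x),\alpha(y),\alpha(z))$ and likewise for $\nearrow$), and, writing $\{x,y,z\}^h=\nwarrow(x,y,z)+\nearrow(x,y,z)-\nearrow(y,x,z)$, $\{x,y,z\}^v=\nwarrow(x,y,z)+\nearrow(z,x,y)-\nearrow(z,y,x)$, $[x,y,z]^C=\{x,y,z\}^h+\{y,z,x\}^h+\{z,x,y\}^h$ (equal to the same cyclic sum of $\{\cdot,\cdot,\cdot\}^v$), the following hold for all $x_1,\dots,x_5\in A$ (where $\circlearrowleft_{1,2,3}$ is the sum over cyclic permutations of the indices $1,2,3$): (0) $\nwarrow(x_1,x_2,x_3)+\nwarrow(x_2,x_1,x_3)=0$; (1) $\nwarrow(\alpha(x_1),\alpha(x_2),\nwarrow(x_3,x_4,x_5))-\nwarrow(\alpha(x_3),\alpha(x_4),\nwarrow(x_1,x_2,x_5))=\nwarrow([x_1,x_2,x_3]^C,\alpha(x_4),\alpha(x_5))-\nwarrow([x_1,x_2,x_4]^C,\alpha(x_3),\alpha(x_5))$;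 (2) $\nwarrow(\alpha(x_1),\alpha(x_2),\nearrow(x_5,x_3,x_4))-\nearrow(\alpha(x_5),\alpha(x_3),\{x_1,x_2,x_4\}^h)=\nearrow(\alpha(x_5),[x_1,x_2,x_3]^C,\alpha(x_4))+\nearrow(\{x_1,x_2,x_5\}^v,\alpha(x_3),\alpha(x_4))$; (3) $\nearrow(\alpha(x_5),\alpha(x_1),\{x_2,x_3,x_4\}^h)-\nwarrow(\alpha(x_2),\alpha(x_3),\nearrow(x_5,x_1,x_4))=\nearrow(\{x_1,x_2,x_5\}^v,\alpha(x_3),\alpha(x_4))-\nearrow(\{x_1,x_3,x_5\}^v,\alpha(x_2),\alpha(x_4))$; (4) $\nwarrow([x_1,x_2,x_3]^C,\alpha(x_4),\alpha(x_5))=\circlearrowleft_{1,2,3}\nwarrow(\alpha(x_1),\alpha(x_2),\nwarrow(x_3,x_4,x_5))$; (5) $\nearrow(\alpha(x_5),[x_1,x_2,x_3]^C,\alpha(x_4))=\circlearrowleft_{1,2,3}\nwarrow(\alpha(x_1),\alpha(x_2),\nearrow(x_5,x_3,x_4))$; (6) $\nwarrow(\alpha(x_1),\alpha(x_2),\nearrow(x_5,x_3,x_4))+\nearrow(\alpha(x_5),\alpha(x_1),\{x_2,x_3,x_4\}^h)=\nearrow(\alpha(x_5),\alpha(x_2),\{x_1,x_3,x_4\}^h)+\nearrow(\{x_1,x_2,x_5\}^v,\alpha(x_3),\alpha(x_4))$. A subalgebra is a linear subspace closed under $\nwarrow$, $\nearrow$ and $\alpha$ (it may be zero). A product structure on $A$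 is a linear map $E:A\to A$ with $E^2=\mathrm{id}_A$ which is a Nijenhuis operator, i.e. $E\alpha=\alpha E$ and, for $\ast\in\{\nwarrow,\nearrow\}$ and all $x,y,z\in A$, $$\ast(Ex,Ey,Ez)=E\big(\ast(Ex,Ey,z)+\ast(Ex,y,Ez)+\ast(x,Ey,Ez)\big)-E^2\big(\ast(Ex,y,z)+\ast(x,Ey,z)+\ast(x,y,Ez)\big)+E^3\ast(x,y,z).$$ *)

(* Defs.v *)
From HB Require Import structures.
From mathcomp Require Import all_boot all_order all_algebra.
From mathcomp Require Import reals complex.
Set Implicit Arguments.
Unset Strict Implicit.
Unset Printing Implicit Defensive.
Import GRing.Theory.
Local Open Scope ring_scope.

Variant ground := RealGround | ComplexGround.

Definition ground_field (R : realType) (k : ground) : fieldType :=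
  match k with RealGround => R | ComplexGround => complex R end.

Section TernaryOperations.
Variables (K : fieldType) (A : vectType K).
Implicit Types (m nw ne : A -> A -> A -> A) (x y z : A).

(* Linear maps A (x) A (x) A -> A are encoded as trilinear curried functions. *)
Definition trilinear m : Prop :=
  [/\ forall y z, linear (fun x => m x y z),
      forall x z, linear (fun y => m x y z)
    & forall x y, linear (fun z => m x y z)].

Definition multiplicative3 (alpha : 'End(A)) m : Prop :=
  forall x y z, alpha (m x y z) = m (alpha x) (alpha y) (alpha z).

Definition hbracket nw ne x y z : A := nw x y z + ne x y z - ne y x z.

Definition vbracket nw ne x y z : A := nw x y z + ne z x y - ne z y x.

(* The cyclic sum of hbracket and the cyclic sum of vbracket coincide. *)
Definition cbracket nw ne x y z : A :=
  hbracket nw ne x y z + hbracket nw ne y z x + hbracket nw ne z x y.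

Definition nijenhuis_for (E : 'End(A)) m : Prop := forall x y z,
  m (E x) (E y) (E z) =
    E (m (E x) (E y) z + m (E x) y (E z) + m x (E y) (E z))
    - E (E (m (E x) y z + m x (E y) z + m x y (E z)))
    + E (E (E (m x y z))).

Definition closed3 (U : {vspace A}) m : Prop :=
  forall x y z, x \in U -> y \in U -> z \in U -> m x y z \in U.

End TernaryOperations.

Record hom3_L_dendriform (K : fieldType) (A : vectType K) := Hom3LDendriform {
  nw : A -> A -> A -> A;
  ne : A -> A -> A -> A;
  alpha : 'End(A);
  nw_trilinear : trilinear nw;
  ne_trilinear : trilinear ne;
  alpha_nw : multiplicative3 alpha nw;
  alpha_ne : multiplicative3 alpha ne;
  nw_skew : forall x1 x2 x3, nw x1 x2 x3 + nw x2 x1 x3 = 0;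
  dend_ax1 : forall x1 x2 x3 x4 x5,
    nw (alpha x1) (alpha x2) (nw x3 x4 x5)
      - nw (alpha x3) (alpha x4) (nw x1 x2 x5) =
    nw (cbracket nw ne x1 x2 x3) (alpha x4) (alpha x5)
      - nw (cbracket nw ne x1 x2 x4) (alpha x3) (alpha x5);
  dend_ax2 : forall x1 x2 x3 x4 x5,
    nw (alpha x1) (alpha x2) (ne x5 x3 x4)
      - ne (alpha x5) (alpha x3) (hbracket nw ne x1 x2 x4) =
    ne (alpha x5) (cbracket nw ne x1 x2 x3) (alpha x4)
      + ne (vbracket nw ne x1 x2 x5) (alpha x3) (alpha x4);
  dend_ax3 : forall x1 x2 x3 x4 x5,
    ne (alpha x5) (alpha x1) (hbracket nw ne x2 x3 x4)
      - nw (alpha x2) (alpha x3) (ne x5 x1 x4) =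
    ne (vbracket nw ne x1 x2 x5) (alpha x3) (alpha x4)
      - ne (vbracket nw ne x1 x3 x5) (alpha x2) (alpha x4);
  dend_ax4 : forall x1 x2 x3 x4 x5,
    nw (cbracket nw ne x1 x2 x3) (alpha x4) (alpha x5) =
    nw (alpha x1) (alpha x2) (nw x3 x4 x5)
      + nw (alpha x2) (alpha x3) (nw x1 x4 x5)
      + nw (alpha x3) (alpha x1) (nw x2 x4 x5);
  dend_ax5 : forall x1 x2 x3 x4 x5,
    ne (alpha x5) (cbracket nw ne x1 x2 x3) (alpha x4) =
    nw (alpha x1) (alpha x2) (ne x5 x3 x4)
      + nw (alpha x2) (alpha x3) (ne x5 x1 x4)
      + nw (alpha x3) (alpha x1) (ne x5 x2 x4);
  dend_ax6 : forall x1 x2 x3 x4 x5,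
    nw (alpha x1) (alpha x2) (ne x5 x3 x4)
      + ne (alpha x5) (alpha x1) (hbracket nw ne x2 x3 x4) =
    ne (alpha x5) (alpha x2) (hbracket nw ne x1 x3 x4)
      + ne (vbracket nw ne x1 x2 x5) (alpha x3) (alpha x4)
}.

Section HomDendriformNotions.
Variables (K : fieldType) (A : vectType K) (D : hom3_L_dendriform A).

Definition subalgebra (U : {vspace A}) : Prop :=
  [/\ closed3 U (nw D), closed3 U (ne D)
    & forall x, x \in U -> alpha D x \in U].

Definition nijenhuis (E : 'End(A)) : Prop :=
  [/\ (E \o alpha D)%VF = (alpha D \o E)%VF,
      nijenhuis_for E (nw D) & nijenhuis_for E (ne D)].

Definition product_structure (E : 'End(A)) : Prop :=
  (E \o E)%VF = \1%VF /\ nijenhuis E.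

End HomDendriformNotions.

(* Main.v *)
Require Import Defs.
From mathcomp Require Import all_boot all_order all_algebra.
From mathcomp Require Import reals complex.
From mathcomp Require Import ring.
Import GRing.Theory Num.Theory VectorInternalTheory passmx.
Local Open Scope ring_scope.

(** Given [E], take the eigenspaces of [E] for [1] and [-1]: on either of them
    the Nijenhuis identity reads [4 m = 4 E m], resp. [- 4 m = 4 E m].
    Conversely let [E] be [1] on [Ap] and [-1] on [Am].  If [E] acts on
    [x, y, z] by signs [a, b, c], the Nijenhuis identity for [m] becomes
    [(abc + a + b + c) m = (ab + bc + ca + 1) E m]; both coefficients vanish
    for mixed signs, and [a = b = c] is covered by closedness. *)

(** Both fields have characteristic zero. Division by 2 is what splits a vector into eigenvectors of
    an involution. *)
Lemma ground_field_two_neq0 (R : realType) (k : ground) :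
  (2%:R : ground_field R k) != 0.
Proof. by case: k; rewrite /= pnatr_eq0. Qed.

Section VectorSpaces.
Set Implicit Arguments.
Unset Strict Implicit.
Variables (K : fieldType) (A : vectType K).
Implicit Types (E : 'End(A)) (U V : {vspace A}) (m : A -> A -> A -> A).
Implicit Types (x y z : A).

Lemma trilinearDl m x x' y z :
  trilinear m -> m (x + x') y z = m x y z + m x' y z.
Proof. by case=> m1 _ _; rewrite -{1}[x]scale1r m1 scale1r. Qed.

Lemma trilinearDm m x y y' z :
  trilinear m -> m x (y + y') z = m x y z + m x y' z.
Proof. by case=> _ m2 _; rewrite -{1}[y]scale1r m2 scale1r. Qed.

Lemma trilinearDr m x y z z' :
  trilinear m -> m x y (z + z') = m x y z + m x y z'.
Proof. by case=> _ _ m3; rewrite -{1}[z]scale1r m3 scale1r. Qed.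

Lemma trilinearZl m a x y z : trilinear m -> m (a *: x) y z = a *: m x y z.
Proof. by case=> m1 _ _; apply: (scalable_linear (m1 y z)). Qed.

Lemma trilinearZm m a x y z : trilinear m -> m x (a *: y) z = a *: m x y z.
Proof. by case=> _ m2 _; apply: (scalable_linear (m2 x z)). Qed.

Lemma trilinearZr m a x y z : trilinear m -> m x y (a *: z) = a *: m x y z.
Proof. by case=> _ _ m3; apply: (scalable_linear (m3 x y)). Qed.

Lemma leigenspaceP E a x : reflect (E x = a *: x) (x \in leigenspace E a).
Proof.
by rewrite memv_ker add_lfunE opp_lfunE scale_lfunE id_lfunE subr_eq0; apply: eqP.
Qed.

Lemma involution_lfunP E : (E \o E)%VF = \1%VF <-> involutive E.
Proof.
split=> [EE x | EK]; first by rewrite -comp_lfunE EE id_lfunE.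
by apply/lfunP=> x; rewrite comp_lfunE id_lfunE.
Qed.

(** The boolean exponent lets one proof serve both eigenvalues. *)
Lemma closed3_leigenspace E m (e : bool) :
    2%:R != 0 :> K -> trilinear m -> involutive E -> nijenhuis_for E m ->
  closed3 (leigenspace E ((-1) ^+ e)) m.
Proof.
move=> nz2 tri_m EK nijE x y z.
move=> /leigenspaceP Ex /leigenspaceP Ey /leigenspaceP Ez; apply/leigenspaceP.
have := nijE x y z; rewrite Ex Ey Ez !EK.
rewrite !(trilinearZl, trilinearZm, trilinearZr) // !(linearD, linearZ) /=.
(* Comparing coordinates through [v2r] leaves scalar equations, within reach of [ring]. *)
move=> /(congr1 v2r)/rowP eqm; apply/v2r_inj/rowP => i; move: (eqm i).
rewrite !(linearD, linearN, linearZ) /= !(linearD, linearZ) /= !mxE => eqi.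
(* After multiplication by 4, the goal is the opposite of [eqi] once the sign is made concrete. *)
apply: (mulfI (mulf_neq0 nz2 nz2)); move/eqP: eqi; rewrite -subr_eq0 => /eqP eqi.
apply/eqP; rewrite -subr_eq0; apply/eqP.
by rewrite -[RHS]oppr0 -eqi; case: (e) => /=; ring.
Qed.

Lemma leigenspace_involution_add E : 2%:R != 0 :> K -> involutive E ->
  (leigenspace E 1 + leigenspace E (-1))%VS = fullv.
Proof.
move=> nz2 EK; apply/vspaceP => x; rewrite memvf.
(* The components in the two eigenspaces are the averages of [x] with [E x] and with [- E x]. *)
have ->: x = 2%:R^-1 *: (x + E x) + 2%:R^-1 *: (x - E x).
  by rewrite -scalerDr addrACA subrr addr0 -mulr2n -scaler_nat scalerA mulVf ?scale1r.
apply: memv_add; apply/rpredZ/leigenspaceP.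
  by rewrite linearD /= EK scale1r addrC.
by rewrite linearB /= EK scaleN1r opprB.
Qed.

(** A vector common to both eigenspaces satisfies [x = E x = - x], so its double vanishes. *)
Lemma directv_leigenspace_opp1 E : 2%:R != 0 :> K ->
  directv (leigenspace E 1 + leigenspace E (-1)).
Proof.
move=> nz2; apply/directv_addP/vspaceP => x; rewrite memv0.
apply/idP/eqP => [|->]; last exact: mem0v.
rewrite memv_cap => /andP[/leigenspaceP Ex /leigenspaceP/eqP].
rewrite Ex scale1r scaleN1r -addr_eq0 -mulr2n -scaler_nat scaler_eq0 (negPf nz2).
by move/eqP.
Qed.

Section Reflection.
Variables (U V : {vspace A}) (E : 'End(A)).
Hypotheses (UV_full : (U + V)%VS = fullv).
Hypotheses (E_U : forall u, u \in U -> E u = u).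
Hypotheses (E_V : forall v, v \in V -> E v = - v).

(** Identities involving [E] are tested on such a decomposition, where [E] only flips the sign of
    the [V] part. *)
Lemma reflection_split x :
  exists u v, [/\ u \in U, v \in V, x = u + v & E x = u - v].
Proof.
have /memv_addP[u uU [v vV ->]] : x \in (U + V)%VS by rewrite UV_full memvf.
by exists u, v; rewrite linearD /= E_U // E_V.
Qed.

Lemma reflection_involutive : involutive E.
Proof.
move=> x; have [u [v [uU vV -> ->]]] := reflection_split x.
by rewrite linearB /= E_U // E_V // opprK.
Qed.

Lemma reflection_nijenhuis_for m :
  trilinear m -> closed3 U m -> closed3 V m -> nijenhuis_for E m.
Proof.
move=> tri_m mU mV x y z.
have [x1 [x2 [x1U x2V -> ->]]] := reflection_split x.
have [y1 [y2 [y1U y2V -> ->]]] := reflection_split y.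
have [z1 [z2 [z1U z2V -> ->]]] := reflection_split z.
(* Signs written as scalars can be pulled out of [m] by homogeneity. *)
rewrite -[- x2]scaleN1r -[- y2]scaleN1r -[- z2]scaleN1r.
do !rewrite !(trilinearDl, trilinearDm, trilinearDr) //.
rewrite !(trilinearZl, trilinearZm, trilinearZr) //.
apply/v2r_inj/rowP => i.
(* Projecting to a coordinate turns the identity into a [ring] problem with
   atoms [f w] and [g w]. *)
pose f w := v2r w 0 i; pose g w := f (E w); rewrite -[LHS]/(f _) -[RHS]/(f _).
have fD u v : f (u + v) = f u + f v by rewrite /f linearD mxE.
have fZ a w : f (a *: w) = a * f w by rewrite /f linearZ mxE.
have fN w : f (- w) = - f w by rewrite /f linearN !mxE.
have gD u v : g (u + v) = g u + g v by rewrite /g linearD fD.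
have gZ a w : g (a *: w) = a * g w by rewrite /g linearZ fZ.
have fE w : f (E w) = g w by [].
have gE w : g (E w) = f w by rewrite /g reflection_involutive.
(* Closedness fixes how [E] acts on the two pure products. For the six mixed ones the values of [f]
   and [g] stay independent and their coefficients cancel. *)
have gU : g (m x1 y1 z1) = f (m x1 y1 z1) by rewrite /g E_U //; apply: mU.
have gV : g (m x2 y2 z2) = - f (m x2 y2 z2) by rewrite /g E_V ?fN //; apply: mV.
do !rewrite !(fD, fN, fZ, gD, gZ, fE, gE); rewrite gU gV.
clearbody f g; clear; ring.
Qed.

End Reflection.

(** The witness is the projection onto [U] along [V] minus the projection onto [V] along [U]. *)
Lemma exists_reflection U V : (U + V)%VS = fullv -> directv (U + V) ->
  exists E, (forall u, u \in U -> E u = u) /\ (forall v, v \in V -> E v = - v).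
Proof.
move=> UV_full /directv_addP UV0; have VU0 : (V :&: U)%VS = 0%VS by rewrite capvC.
exists (daddv_pi U V - daddv_pi V U); split=> w wW;
  rewrite add_lfunE opp_lfunE.
(* The two projections of [w] sum to [w] and one of them is already [w], so the other vanishes. *)
- have := daddv_pi_add UV0 (memv_add wW (mem0v V)); rewrite addr0.
  by rewrite (daddv_pi_id UV0 wW) => /(canRL (addKr _)) ->; rewrite addNr subr0.
- have := daddv_pi_add VU0 (memv_add wW (mem0v U)); rewrite addr0.
  by rewrite (daddv_pi_id VU0 wW) => /(canRL (addKr _)) ->; rewrite addNr add0r.
Qed.

End VectorSpaces.

Section ProductStructures.
Set Implicit Arguments.
Unset Strict Implicit.
Variables (K : fieldType) (A : vectType K) (D : hom3_L_dendriform A).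

Lemma subalgebra_leigenspace E (e : bool) :
  2%:R != 0 :> K -> product_structure D E ->
  subalgebra D (leigenspace E ((-1) ^+ e)).
Proof.
move=> nz2 [/involution_lfunP EK [Ealpha nijw nije]]; split.
- exact: (closed3_leigenspace nz2 (nw_trilinear D) EK nijw).
- exact: (closed3_leigenspace nz2 (ne_trilinear D) EK nije).
(* An operator commuting with [E] preserves its eigenspaces. *)
move=> x /leigenspaceP Ex; apply/leigenspaceP.
by rewrite -comp_lfunE Ealpha comp_lfunE Ex linearZ.
Qed.

Lemma reflection_product_structure (U V : {vspace A}) (E : 'End(A)) :
    subalgebra D U -> subalgebra D V -> (U + V)%VS = fullv ->
    (forall u, u \in U -> E u = u) -> (forall v, v \in V -> E v = - v) ->
  product_structure D E.
Proof.
move=> [nwU neU alphaU] [nwV neV alphaV] UV_full E_U E_V; split.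
  exact/involution_lfunP/(reflection_involutive UV_full E_U E_V).
split; last 2 first.
- exact: (reflection_nijenhuis_for UV_full E_U E_V (nw_trilinear D) nwU nwV).
- exact: (reflection_nijenhuis_for UV_full E_U E_V (ne_trilinear D) neU neV).
(* [alpha] preserves both summands, so on each of them [E] acts by the same sign before and after
   [alpha]. *)
apply/lfunP=> x; rewrite !comp_lfunE.
have [u [v [uU vV -> ->]]] := reflection_split UV_full E_U E_V x.
by rewrite linearB !linearD /= E_U ?alphaU // E_V ?alphaV.
Qed.

End ProductStructures.

Theorem theorem4p7 (R : realType) (k : ground)
    (A : vectType (ground_field R k)) (D : hom3_L_dendriform A) :
  (exists E : 'End(A), product_structure D E) <->
  (exists Ap Am : {vspace A},
     [/\ subalgebra D Ap, subalgebra D Am,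
         (Ap + Am)%VS = fullv & directv (Ap + Am)]).
Proof.
have nz2 := ground_field_two_neq0 R k; split=> [[E prodE] | [Ap [Am]]].
  have [/involution_lfunP EK _] := prodE.
  exists (leigenspace E 1), (leigenspace E (-1)); split.
  (* [(-1) ^+ false] and [(-1) ^+ true] are [1] and [-1] by computation. *)
  - exact: (subalgebra_leigenspace false nz2 prodE).
  - exact: (subalgebra_leigenspace true nz2 prodE).
  - exact: leigenspace_involution_add.
  - exact: directv_leigenspace_opp1.
case=> subAp subAm fullA directA.
have [E [E_Ap E_Am]] := exists_reflection fullA directA.
by exists E; apply: reflection_product_structure subAp subAm fullA E_Ap E_Am.
Qed.
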